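(* For every cv-cycle type $\check{\lambda}$ and every integer $k\ge0$, the cv-cycle type colored Eulerian quasisymmetric function $Q_{\check{\lambda},k}$ is a symmetric function, i.e., it is invariant under every permutation of the variables $x_1,x_2,\dots$.
   Context: Fix a positive integer $l$ and commuting indeterminates $x_1,x_2,\dots$. Let $\mathcal{B}$ be the alphabet consisting of the letters $u^m$ ($u\ge1$, $0\le m\le l-1$) and the barred letters $\overline{u^0}$ ($u\ge1$). $u^m$ is $m$-colored and $\overline{u^0}$ is $0$-colored; both have absolute value $u$ and weight $x_u$. A colored necklace is a circular word over $\mathcal{B}$ (up to rotation, read clockwise) which is primitive (not a concatenation of $\ge2$ copies of a proper subword) and satisfies: (1) every barred letter is followed by a letter of lesser or equal absolute value; (2) every $0$-colored unbarred letter is followed by a letter of greater or equal absolute value; (3) a necklace of length one is not a single barred letter. A colored ornament is a finite multiset of colored necklaces, with weight the product of the weights of its letters. The color vector of a word or necklace is $(\beta_1,\dots,\beta_{l-1})$, where $\beta_m$ is the number of $m$-colored letters ($m\ge1$). A cv-cycle type is a finite multiset $\check{\lambda}=\{(\lambda_1,\vec{\beta^1}),\dots,(\lambda_i,\vec{\beta^i})\}$ with $\lambda_1\ge\dots\ge\lambda_i\ge1$ and $\vec{\beta^j}\in\mathbb{N}^{l-1}$; the cv-cycle type of an ornament is the multiset of pairs (length, color vector) of its necklaces. $Q_{\check{\lambda},k}$ is the sum of the weights of all colored ornaments of cv-cycle type $\check{\lambda}$ having exactly $k$ barred letters. (By Hyatt's colored ornament interpretation this coincides with the paper's definition $Q_{\check{\lambda},k}=\sum_\pi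 F_{n,\mathrm{DEX}(\pi)}$ over colored permutations of cv-cycle type $\check\lambda$ with $k$ excedances.) *)

(* Defs.v *)
From mathcomp Require Import all_boot.
Set Implicit Arguments. Unset Strict Implicit. Unset Printing Implicit Defensive.

(* A letter of the alphabet B is a triple ((u, m), b):
   u = absolute value, m = color, b = barred?  Its weight is x_u. *)
Definition letter := ((nat * nat) * bool)%type.
Definition labs (x : letter) : nat := x.1.1.
Definition lcol (x : letter) : nat := x.1.2.
Definition lbar (x : letter) : bool := x.2.

Definition valid_letter (l : nat) (x : letter) : bool :=
  [&& 0 < labs x, lcol x < l & lbar x ==> (lcol x == 0)].

Definition primitive (w : seq letter) : bool :=
  ~~ has (fun d => (1 < d) && (w == flatten (nseq d (take (size w %/ d) w))))
         (iota 0 (size w).+1).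

Definition follow_ok (a b : letter) : bool :=
  (lbar a ==> (labs b <= labs a)) &&
  ((~~ lbar a && (lcol a == 0)) ==> (labs a <= labs b)).

(* w is a representative (linear reading) of a colored necklace *)
Definition necklace (l : nat) (w : seq letter) : bool :=
  [&& 0 < size w, all (valid_letter l) w, primitive w,
      all (fun p => follow_ok p.1 p.2) (zip w (rot 1 w)) &
      (size w == 1) ==> ~~ lbar (head (0, 0, false) w)].

Definition colvec (l : nat) (w : seq letter) : seq nat :=
  [seq count (fun x => lcol x == m) w | m <- iota 1 l.-1].

Definition rot_eqb (w w' : seq letter) : bool :=
  has (fun r => rot r w == w') (iota 0 (size w).+1).

Definition rem_nth (T : Type) (j : nat) (s : seq T) : seq T := take j s ++ drop j.+1 s.

(* two lists of words represent the same multiset of necklaces *)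
Fixpoint orn_eq (o o' : seq (seq letter)) : bool :=
  match o with
  | [::] => o' == [::]
  | w :: o1 =>
      has (fun j => rot_eqb w (nth [::] o' j) && orn_eq o1 (rem_nth j o'))
          (iota 0 (size o'))
  end.

Fixpoint nclasses (T : Type) (e : rel T) (s : seq T) : nat :=
  match s with
  | [::] => 0
  | x :: s' => (~~ has (e x) s') + nclasses e s'
  end.

Fixpoint words (L : seq letter) (j : nat) : seq (seq letter) :=
  if j is j'.+1 then [seq x :: w | x <- L, w <- words L j'] else [:: [::]].

(* a cv-cycle type is a multiset of pairs (lambda_j, beta^j), given by a list *)
Definition cvtype := seq (nat * seq nat).
Definition wf_cvtype (l : nat) (lam : cvtype) : bool :=
  all (fun p => (0 < p.1) && (size p.2 == l.-1)) lam.

Fixpoint cand_orns (L : seq letter) (lam : cvtype) : seq (seq (seq letter)) :=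
  match lam with
  | [::] => [:: [::]]
  | p :: lam' => [seq w :: o | w <- words L p.1, o <- cand_orns L lam']
  end.

Definition letters_of (l : nat) (mon : seq nat) : seq letter :=
  [seq x <- flatten [seq [seq ((u, m), b) | m <- iota 0 l, b <- [:: false; true]]
                    | u <- undup mon]
   | valid_letter l x].

(* o is (a listing of) a colored ornament of cv-cycle type lam,
   with k barred letters and weight x_mon = prod_{u in mon} x_u *)
Definition good_orn (l : nat) (lam : cvtype) (k : nat) (mon : seq nat)
    (o : seq (seq letter)) : bool :=
  [&& all2 (fun w p => [&& necklace l w, size w == p.1 & colvec l w == p.2]) o lam,
      sumn [seq count lbar w | w <- o] == k &
      perm_eq (flatten [seq map labs w | w <- o]) mon].

(* Coefficient of the monomial x_{mon_1} ... x_{mon_n} in Q_{lam,k}: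
   the number of colored ornaments (multisets of necklaces) of cv-cycle type
   lam with exactly k barred letters and that weight. *)
Definition Qcoef (l : nat) (lam : cvtype) (k : nat) (mon : seq nat) : nat :=
  nclasses orn_eq [seq o <- cand_orns (letters_of l mon) lam | good_orn l lam k mon o].

(* Main.v *)
(* By unique factorization of a word as a power of a primitive word, symmetry for
   multisets of necklaces reduces to symmetry of the number of closed words
   w_1 ... w_n (w_n followed by w_1) with given letter statistics.  The generating
   function of closed words is the trace of A^n, where A_ij = x_i F_ij and F_ij
   depends only on how i and j compare.  In det(X - A) the coefficient of
   prod_(i in S) x_i is, up to a power of X, a principal minor of -F, which depends only
   on the size of S; so the characteristic polynomial, hence the trace of A^n, is
   unchanged when the letters are compared in another order. *)
Require Import Defs.
From mathcomp Require Import fingroup perm.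
From mathcomp Require Import all_boot all_order all_algebra algC.
Set Implicit Arguments. Unset Strict Implicit. Unset Printing Implicit Defensive.
Import GRing.Theory Num.Theory.

(** * Traces and principal minors *)

Section TracePowers.
Local Open Scope ring_scope.

Lemma char_poly_conj (F : fieldType) n (P A : 'M[F]_n) :
  P \in unitmx -> char_poly (P *m A *m invmx P) = char_poly A.
Proof.
move=> uP; rewrite /char_poly /char_poly_mx !map_mxM /=.
set Q := map_mx polyC P; set Q' := map_mx polyC (invmx P).
have QQ' : Q *m Q' = 1%:M by rewrite -map_mxM mulmxV ?map_mx1.
rewrite (_ : _ - _ = Q *m ('X%:M - map_mx polyC A) *m Q'); last first.
  rewrite mulmxBr mulmxBl scalar_mxC.
  by rewrite -[X in _ = X - _]mulmxA QQ' mulmx1.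
by rewrite !det_mulmx mulrAC -det_mulmx QQ' det1 mul1r.
Qed.

Lemma trig_mulmx_diag (R : pzRingType) n (A B : 'M[R]_n) :
  is_trig_mx A -> is_trig_mx B ->
  is_trig_mx (A *m B) /\ forall i, (A *m B) i i = A i i * B i i.
Proof.
move=> /is_trig_mxP tA /is_trig_mxP tB; split.
  apply/is_trig_mxP => i j ij; rewrite mxE big1 // => k _.
  case: (ltnP i k) => ik; first by rewrite tA ?mul0r.
  by rewrite tB ?mulr0 //; apply: leq_ltn_trans ij.
move=> i; rewrite mxE (bigD1 i) //= big1 ?addr0 // => k ki.
case: (ltngtP i k) => ik; first by rewrite tA ?mul0r.
  by rewrite tB ?mulr0.
by move: ki; rewrite (ord_inj ik) eqxx.
Qed.

(** By Schur, [A] is conjugate to a triangular matrix [T]. Its diagonal lists the eigenvalues, and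
    the diagonal of [T ^+ k] lists their [k]-th powers. *)
Lemma mxtrace_expr_eigen (C : numClosedFieldType) n (A : 'M[C]_n.+1) :
  exists s : seq C, char_poly A = \prod_(a <- s) ('X - a%:P) /\
    forall k, \tr (A ^+ k) = \sum_(a <- s) a ^+ k.
Proof.
have [//|P /unitarymx_unit uP] := Schur A.
rewrite /similar_to /= conjumx //; set T := _ *m _ => tT.
exists [seq T i i | i <- enum 'I_n.+1]; split.
  by rewrite -(char_poly_conj A uP) char_poly_trig // big_map big_enum.
move=> k; rewrite big_map big_enum /=.
have TX : P *m A ^+ k *m invmx P = T ^+ k.
  elim: k => [|k IH]; first by rewrite !expr0 mulmx1 mulmxV.
  rewrite !exprS -!mulmxE -IH /T !mulmxA.
  by rewrite (mulmxKV uP).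
have [_ dT] : is_trig_mx (T ^+ k) /\ forall i, (T ^+ k) i i = T i i ^+ k.
  elim: k {TX} => [|k [IHt IHd]].
    rewrite expr0; split; first exact: scalar_mx_is_trig.
    by move=> i; rewrite expr0 mxE eqxx.
  have [tTk dTk] := trig_mulmx_diag tT IHt.
  rewrite exprS -mulmxE; split=> // i.
  by rewrite dTk IHd exprS.
transitivity (\tr (T ^+ k)).
  by rewrite -TX mxtrace_mulC mulmxA mulVmx // mul1mx.
by apply: eq_bigr => i _; rewrite dT.
Qed.

(** The characteristic polynomial determines the multiset of its roots, hence all their power
    sums. *)
Lemma mxtrace_expr_char_poly (C : numClosedFieldType) n (A B : 'M[C]_n.+1) k :
  char_poly A = char_poly B -> \tr (A ^+ k) = \tr (B ^+ k).
Proof.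
have [s [cA ->]] := mxtrace_expr_eigen A.
have [t [cB ->]] := mxtrace_expr_eigen B.
by rewrite cA cB => /prod_XsubC_eq st; apply: perm_big.
Qed.

End TracePowers.

(** * Principal minors do not depend on the order *)

Section OrderMatrix.
Local Open Scope ring_scope.

(** List [S] in increasing order for [f] and for [g]: [h] sends the element at a given position of
    the [g]-list to the one at the same position of the [f]-list. *)
Lemma order_transport_perm (I : finType) (f g : I -> nat) (S : {set I}) :
  injective f -> injective g ->
  exists h : {perm I}, {in S, forall i, h i \in S} /\
    {in S &, forall i j, (f (h i) <= f (h j))%N = (g i <= g j)%N} /\
    {in ~: S, forall i, h i = i}.
Proof.
move=> injf injg.
pose sf := sort (relpre f leq) (enum S); pose sg := sort (relpre g leq) (enum S).
have mf i : (i \in sf) = (i \in S) by rewrite mem_sort mem_enum.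
have mg i : (i \in sg) = (i \in S) by rewrite mem_sort mem_enum.
have uf : uniq sf by rewrite sort_uniq enum_uniq.
have ug : uniq sg by rewrite sort_uniq enum_uniq.
have szE : size sf = size sg by rewrite !size_sort.
pose h i := if i \in S then nth i sf (index i sg) else i.
have hS i : i \in S -> h i \in S.
  by move=> iS; rewrite /h iS -mf mem_nth // szE index_mem mg.
have injh : injective h.
  move=> i j; case iS: (i \in S); case jS: (j \in S).
  (* The default of [nth] in [h] is the argument itself, so it must be made common before positions
     can be compared. *)
  - rewrite /h iS jS (set_nth_default i j) ?szE ?index_mem ?mg // => /eqP.
    rewrite nth_uniq ?szE ?index_mem ?mg // => /eqP eij.
    by rewrite -(@nth_index _ i i sg) ?mg // eij nth_index // mg.
  - by move=> e; move: (hS _ iS); rewrite e /h jS jS.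
  - by move=> e; move: (hS _ jS); rewrite -e /h iS iS.
  - by rewrite /h iS jS.
exists (perm injh); split; first by move=> i iS; rewrite permE hS.
split; last by move=> i; rewrite inE permE /h => /negbTE ->.
(* Along a list sorted by an injective key, comparing keys amounts to comparing positions. *)
have mono (k : I -> nat) s : injective k -> uniq s -> sorted (relpre k leq) s ->
    forall d d' a b, (a < size s)%N -> (b < size s)%N ->
    (k (nth d s a) <= k (nth d' s b))%N = (a <= b)%N.
  move=> injk us ss d d' a b la lb; rewrite (set_nth_default d d') //.
  have tr : transitive (relpre k leq) by move=> x y z /=; apply: leq_trans.
  have H := sorted_ltn_nth tr d ss.
  case: (ltngtP a b) => [ab|ba|->]; last by rewrite leqnn.
    by apply: H.
  have /= Hba := H b a lb la ba.
  apply/negbTE; rewrite -ltnNge ltn_neqAle Hba andbT.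
  by apply/eqP => /injk /eqP; rewrite nth_uniq // ltn_eqF.
have srt (k : I -> nat) : sorted (relpre k leq) (sort (relpre k leq) (enum S)).
  by apply: sort_sorted => x y; apply: leq_total.
move=> i j iS jS; rewrite !permE /h iS jS (mono f) ?szE ?index_mem ?mg //.
by rewrite -(mono g sg injg ug (srt g) i j) ?index_mem ?mg // !nth_index ?mg.
Qed.

Variables (R : comPzRingType) (N : nat) (F : bool -> bool -> R).

Definition order_mx (f : 'I_N -> nat) : 'M[R]_N :=
  \matrix_(i, j) F (f i <= f j)%N (f j <= f i)%N.

(** Padding with the identity outside [S] gives a matrix of fixed size whose determinant is the
    principal minor on [S]. *)
Definition principal_mx (S : {set 'I_N}) (f : 'I_N -> nat) : 'M[R]_N :=
  \matrix_(i, j) if i \in S then order_mx f i j *+ (j \in S) else (i == j)%:R.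

(** Permuting rows and columns simultaneously by the rank-matching permutation of [S] carries one
    matrix to the other, and the two signs cancel. *)
Lemma det_principal_mx (S : {set 'I_N}) (f g : 'I_N -> nat) :
  injective f -> injective g -> \det (principal_mx S f) = \det (principal_mx S g).
Proof.
move=> injf injg; have [h [hS [hm hC]]] := order_transport_perm S injf injg.
have -> : principal_mx S g = col_perm h (row_perm h (principal_mx S f)).
  apply/matrixP => i j; rewrite !mxE.
  have hSE k : (h k \in S) = (k \in S).
    apply/idP/idP => [|/hS //]; case kS: (k \in S) => //.
    by rewrite hC ?inE ?kS // kS.
  rewrite !hSE; case iS: (i \in S); last by rewrite (inj_eq perm_inj).
  by case jS: (j \in S); rewrite ?mulr0n // !hm.
rewrite col_permE row_permE.
by rewrite !det_mulmx mulrAC -det_mulmx -perm_mxM mulgV perm_mx1 det1 mul1r.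
Qed.

(** Expand the product over the rows in each term of the Leibniz formula: [S] is the set of rows in
    which the [x i] summand is taken. *)
Lemma det_diagD (f : 'I_N -> nat) (a x : 'I_N -> R) :
  \det (\matrix_(i, j) (a i *+ (i == j) + x i * order_mx f i j)) =
  \sum_(S : {set 'I_N}) (\prod_i if i \in S then x i else a i) * \det (principal_mx S f).
Proof.
rewrite /determinant.
under eq_bigr => s _.
  under eq_bigr => i _ do rewrite mxE addrC.
  rewrite bigA_distr mulr_sumr; over.
rewrite exchange_big; apply: eq_bigr => S _ /=.
rewrite mulr_sumr; apply: eq_bigr => s _.
rewrite mulrCA; congr (_ * _); rewrite -big_split /=.
(* A permutation moving some index outside [S] contributes a zero factor on both sides; any other
   one preserves [S]. *)
case: (boolP [forall i, (i \in S) || (s i == i)]) => [/forallP sC|].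
  have sS i : i \in S -> s i \in S.
    move=> iS; have := sC (s i); case: (boolP (s i \in S)) => //= siS.
    by rewrite (inj_eq perm_inj) => /eqP si; rewrite si iS in siS.
  apply: eq_bigr => i _; rewrite [principal_mx S f i _]mxE.
  case: ifP => iS; first by rewrite sS.
  by rewrite mulr_natr.
case/forallPn => i; rewrite negb_or => /andP [/negbTE iS /negbTE si].
rewrite (bigD1 i) //= iS eq_sym si mulr0n mul0r.
by rewrite [RHS](bigD1 i) //= mxE iS eq_sym si mulr0 mul0r.
Qed.

Lemma det_diagD_order (f g : 'I_N -> nat) (a x : 'I_N -> R) :
  injective f -> injective g ->
  \det (\matrix_(i, j) (a i *+ (i == j) + x i * order_mx f i j)) =
  \det (\matrix_(i, j) (a i *+ (i == j) + x i * order_mx g i j)).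
Proof.
move=> injf injg; rewrite !det_diagD.
by apply: eq_bigr => S _; rewrite (det_principal_mx S injf injg).
Qed.

End OrderMatrix.

(** The characteristic matrix has the shape of [det_diagD] over the polynomial ring, with [a i]
    equal to ['X] and [- x i] in place of [x i]. *)
Lemma char_poly_order (R : comNzRingType) N (F : bool -> bool -> R)
    (x : 'I_N -> R) (f g : 'I_N -> nat) :
  injective f -> injective g ->
  char_poly (\matrix_(i, j) (x i * order_mx F f i j)%R) =
  char_poly (\matrix_(i, j) (x i * order_mx F g i j)%R).
Proof.
move=> injf injg; pose G b c := polyC (F b c).
suff E h : char_poly (\matrix_(i, j) (x i * order_mx F h i j)%R) =
    (\det (\matrix_(i, j) ('X *+ (i == j) + (- (x i)%:P) * order_mx G h i j)))%R.
  by rewrite !E; apply: det_diagD_order.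
by congr (\det _)%R; apply/matrixP => i j; rewrite !mxE polyCM mulNr.
Qed.

(** * Closed words *)

(** The value 0, which no valid letter has, is included so that absolute values index the rows of a
    matrix; it is excluded again through the letter statistics. *)
Definition alphabet N (CB : seq (nat * bool)) : seq letter :=
  [seq ((u, c.1), c.2) | u <- iota 0 N, c <- CB].

Definition relab (f : nat -> nat) (x : letter) : letter := ((f (labs x), lcol x), lbar x).

(** Only the comparison goes through [f]. The alphabet and the weights stay fixed, so a change of
    order is just a change of relation. *)
Definition follow (f : nat -> nat) : rel letter :=
  fun x y => follow_ok (relab f x) (relab f y).

(** An additive weight with values in [nat] makes the generating function a polynomial in one
    variable; [p] and [h] are later chosen to encode all letter statistics in one number. *)
Definition wt (p : nat -> nat) (h : nat * bool -> nat) (w : seq letter) : nat :=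
  \sum_(x <- w) (p (labs x) + h (lcol x, lbar x)).

Lemma mem_words (L : seq letter) n w : (w \in words L n) = (size w == n) && all (mem L) w.
Proof.
elim: n w => [|n IH] [|x w] //=; first by apply/allpairsP => -[[y v] []].
apply/allpairsP/idP => [[[y v] [/= yL vL [-> ->]]]|].
  by rewrite eqSS; move: vL; rewrite IH => /andP [-> ->]; rewrite yL.
by rewrite eqSS => /and3P [sw xL wL]; exists (x, w); rewrite /= IH sw wL.
Qed.

Lemma words_uniq (L : seq letter) n : uniq L -> uniq (words L n).
Proof.
move=> uL; elim: n => [|n IH] //=; apply: allpairs_uniq => //.
by move=> [x v] [y w] _ _ /= [-> ->].
Qed.

Lemma alphabet_uniq N CB : uniq CB -> uniq (alphabet N CB).
Proof.
move=> uC; apply: allpairs_uniq; rewrite ?iota_uniq //.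
by move=> [x [v b]] [y [w c]] _ _ /= [-> -> ->].
Qed.

Lemma mem_alphabet N CB x :
  (x \in alphabet N CB) = (labs x < N) && ((lcol x, lbar x) \in CB).
Proof.
case: x => [[u m] b] /=; apply/allpairsP/andP => /=.
  by case=> -[v [m' b']] /= [vN cC [-> -> ->]]; rewrite mem_iota in vN.
by case=> uN cC; exists (u, (m, b)); rewrite /= mem_iota.
Qed.

Section ClosedWalks.
Local Open Scope ring_scope.

Variables (C : numClosedFieldType) (z : C) (N' : nat) (CB : seq (nat * bool)).
Variables (p : nat -> nat) (h : nat * bool -> nat) (f : nat -> nat).
Let N := N'.+1.
Let L := alphabet N CB.
Let e := follow f.
(* [e x (mark j)] only sees the absolute value of its second argument. *)
Let mark (j : 'I_N) : letter := ((j : nat, 0), false)%N.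

(** A transfer matrix: a word is a walk through the absolute values of its letters, and each letter
    is a weighted step. *)
Definition walk_mx : 'M[C]_N :=
  \matrix_(i, j) \sum_(x <- L) z ^+ wt p h [:: x] *+ ((labs x == i) && e x (mark j)).

(** [mark j] stands for the letter following the word. For the empty word it is also the head, which
    gives the identity matrix at [n = 0]. *)
Lemma walk_mx_expr n (i j : 'I_N) :
  (walk_mx ^+ n) i j = \sum_(w <- words L n) z ^+ wt p h w *+
    ((labs (head (mark j) w) == i) && sorted e (rcons w (mark j))).
Proof.
elim: n i => [|n IH] i.
  by rewrite expr0 mxE big_seq1 /= /wt big_nil expr0 andbT eq_sym.
rewrite exprS -mulmxE mxE /= big_allpairs_dep /=.
under eq_bigr => k _ do rewrite IH mxE mulr_suml.
rewrite exchange_big; apply: eq_bigr => x _ /=.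
under eq_bigr => k _ do rewrite mulr_sumr.
rewrite exchange_big; rewrite big_seq [RHS]big_seq; apply: eq_bigr => w wL /=.
have HN : (labs (head (mark j) w) < N)%N.
  case: w wL => [_|y w]; [exact: ltn_ord | rewrite mem_words /=].
  case/and3P => _ yL _.
  by move: yL; rewrite mem_alphabet => /andP [].
(* Only the intermediate index equal to the absolute value of the head of [w] contributes. *)
rewrite (bigD1 (Ordinal HN)) //= big1 ?addr0; last first.
  move=> k kH; rewrite (_ : (_ == k :> nat) = false) ?mulr0 //.
  by apply/negbTE; apply: contra kH => /eqP E; apply/eqP/val_inj.
rewrite eqxx /= mulrnAl mulrnAr -exprD -mulrnA mulnb.
have -> : (wt p h [:: x] + wt p h w)%N = wt p h (x :: w).
  by rewrite /wt big_seq1 big_cons.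
congr (_ *+ nat_of_bool _).
by case: w {wL} HN => [|y w] HN /=; rewrite ?andbT; do ?case: (_ == _);
   rewrite ?andbF ?andbT //= andbC.
Qed.

(** A diagonal entry forces the letter after the last one to have the absolute value of the first,
    which closes the word. At [n = 0] the trace would count the empty word once per index. *)
Lemma mxtrace_walk n : (0 < n)%N ->
  \tr (walk_mx ^+ n) = \sum_(w <- words L n) z ^+ wt p h w *+ cycle e w.
Proof.
move=> n0; rewrite /mxtrace.
under eq_bigr => i _ do rewrite walk_mx_expr.
rewrite exchange_big; rewrite big_seq [RHS]big_seq; apply: eq_bigr => w /=.
rewrite mem_words => /andP [/eqP sw wL].
case: w sw wL => [sw|x w _ /=]; first by rewrite -sw in n0.
rewrite mem_alphabet => /andP [/andP [xN _] _].
rewrite (bigD1 (Ordinal xN)) //= big1 ?addr0; last first.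
  move=> k kH; rewrite (_ : (_ == k :> nat) = false) ?mulr0n //.
  by apply/negbTE; apply: contra kH => /eqP E; apply/eqP/val_inj.
by rewrite eqxx /= !rcons_path.
Qed.

(** The following rule sees two absolute values only through their two comparisons, so summing over
    colors and bars gives the form required by [char_poly_order]. *)
Lemma walk_mxE : walk_mx = \matrix_(i, j) (z ^+ p i * order_mx (fun b c =>
  \sum_(d <- CB) z ^+ h d *+ ((d.2 ==> c) && (~~ d.2 && (d.1 == 0%N) ==> b)))
   (f \o val) i j).
Proof.
apply/matrixP => i j; rewrite !mxE big_allpairs_dep /=.
have iN : (i : nat) \in iota 0 N by rewrite mem_iota ltn_ord.
rewrite (bigD1_seq _ iN (iota_uniq _ _)) /=.
rewrite [X in _ + X]big1 ?addr0; last first.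
  by move=> k /negbTE ki; rewrite big1 // => c _; rewrite /labs /= ki mulr0n.
rewrite mulr_sumr; apply: eq_bigr => -[m b] _; rewrite /labs /= eqxx /=.
by rewrite /wt big_seq1 /= exprD mulrnAr.
Qed.

End ClosedWalks.

Lemma poly_eq_horner (C : numClosedFieldType) (P Q : {poly C}) :
  (forall z, P.[z] = Q.[z])%R -> P = Q.
Proof.
move=> PQ; apply/eqP; rewrite -subr_eq0; apply/negPn/negP => nz.
(* These are [size (P - Q)] distinct integers, one more than the degree allows as roots. *)
pose s := [seq (i%:R : C)%R | i <- iota 0 (size (P - Q)%R)].
suff : size s < size (P - Q)%R by rewrite size_map size_iota ltnn.
apply: max_poly_roots => //.
  by apply/allP => z _; rewrite /root hornerD hornerN PQ subrr.
by rewrite map_inj_uniq ?iota_uniq //; apply: mulrIn; apply: oner_neq0.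
Qed.

(** Both counts are coefficients of ['X^e] in polynomials whose values at [z] are traces of powers
    of [walk_mx]; these traces agree because the characteristic polynomials do. *)
Lemma count_cyclic_words N CB p h f g n e :
  injective f -> injective g -> 0 < n ->
  count (fun w => cycle (follow f) w && (wt p h w == e)) (words (alphabet N CB) n) =
  count (fun w => cycle (follow g) w && (wt p h w == e)) (words (alphabet N CB) n).
Proof.
case: N => [|N]; first by case: n.
move=> injf injg n0; pose W := words (alphabet N.+1 CB) n.
pose P k : {poly algC} := (\sum_(w <- W) 'X^(wt p h w) *+ cycle (follow k) w)%R.
have PE : P f = P g.
  apply: poly_eq_horner => z; rewrite /P.
  have hs k : ((P k).[z] = \sum_(w <- W) z ^+ wt p h w *+ cycle (follow k) w)%R.
    rewrite /P -horner_evalE raddf_sum; apply: eq_bigr => w _.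
    by rewrite raddfMn /= horner_evalE hornerXn.
  rewrite !hs -!mxtrace_walk //; apply: mxtrace_expr_char_poly.
  rewrite !walk_mxE; apply: char_poly_order.
    by move=> i j /injf /val_inj.
  by move=> i j /injg /val_inj.
have cE k : ((P k)`_e = (count (fun w => cycle (follow k) w && (wt p h w == e)) W)%:R)%R.
  rewrite /P coef_sum -sum1_count natr_sum [RHS]big_mkcond /=; apply: eq_bigr => w _.
  by rewrite coefMn coefXn eq_sym; case: (cycle _ _); case: (_ == _); rewrite ?mulr0n ?mul0rn.
by apply/eqP; rewrite -(eqr_nat algC) -!cE PE.
Qed.

(** * Periods and rotations *)

Section Period.
Variable T : eqType.
Implicit Types u v w : seq T.

Definition pow d w := flatten (nseq d w).

Lemma powS d w : pow d.+1 w = w ++ pow d w. Proof. by []. Qed.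

Lemma size_pow d w : size (pow d w) = d * size w.
Proof. by elim: d => [|d IH] //; rewrite powS size_cat IH. Qed.

Lemma iter_rot1 k w : k <= size w -> iter k (rot 1) w = rot k w.
Proof.
elim: k => [|k IH] kw; first by rewrite rot0.
by rewrite iterS IH 1?ltnW // -[RHS]/(rot (1 + k) w) rotD.
Qed.

Lemma size_iter_rot1 k w : size (iter k (rot 1) w) = size w.
Proof. by elim: k => [|k IH] //=; rewrite size_rot. Qed.

Lemma perm_iter_rot1 k w : perm_eq (iter k (rot 1) w) w.
Proof. by elim: k => [|k IH] //=; rewrite perm_rot. Qed.

Lemma iter_rot1_inj k : injective (iter k (@rot T 1)).
Proof. by elim: k => [|k IH] u v //= /rot_inj /IH. Qed.

(** Iterating [rot 1] is meaningful for every [k], whereas [rot k] is the identity beyond the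
    length. *)
Definition fixes w k := iter k (rot 1) w == w.

Lemma fixes_size w : fixes w (size w).
Proof. by rewrite /fixes iter_rot1 // rot_size. Qed.

Lemma fixesD w k m : fixes w k -> fixes w (m + k) = fixes w m.
Proof. by rewrite /fixes iterD => /eqP ->. Qed.

Lemma fixesM w k m : fixes w k -> fixes w (m * k).
Proof. by move=> wk; elim: m => [|m IH]; [apply/eqP | rewrite mulSnr fixesD]. Qed.

Lemma period_ex w : exists k, (0 < k) && fixes w k.
Proof.
case: w => [|x w]; first by exists 1.
by exists (size w).+1; rewrite (fixes_size (x :: w)).
Qed.

Definition period w := ex_minn (period_ex w).

(** If [k] fixes [w], so does its remainder modulo the period, which is then zero by minimality. *)
Lemma fixes_period w k : fixes w k = (period w %| k).
Proof.
rewrite /period; case: ex_minnP => p /andP [p0 wp] pmin.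
apply/idP/dvdnP => [wk|[m ->]]; last exact: fixesM.
exists (k %/ p); move: wk; rewrite {1}(divn_eq k p) addnC fixesD ?fixesM // => wr.
rewrite {1}(divn_eq k p); case: (posnP (k %% p)) => [->|r0]; first by rewrite addn0.
by have := pmin (k %% p); rewrite r0 wr leqNgt ltn_pmod // => /(_ isT).
Qed.

Lemma period_gt0 w : 0 < period w.
Proof. by rewrite /period; case: ex_minnP => p /andP []. Qed.

Lemma period_dvd w : period w %| size w.
Proof. by rewrite -fixes_period fixes_size. Qed.

Lemma eq_period u v : fixes u =1 fixes v -> period u = period v.
Proof.
move=> uv; apply/eqP; rewrite eqn_dvd -!fixes_period uv -(uv (period u)).
by rewrite !fixes_period !dvdnn.
Qed.

Lemma period_iter_rot1 k w : period (iter k (rot 1) w) = period w.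
Proof.
apply: eq_period => m; rewrite /fixes -iterD addnC iterD.
by rewrite (inj_eq (@iter_rot1_inj k)).
Qed.

Lemma pow_rcons d x v : rcons (pow d (x :: v)) x = x :: pow d (rcons v x).
Proof.
elim: d => [|d IH] //; rewrite !powS rcons_cat IH /=.
by rewrite cat_rcons.
Qed.

Lemma rot1_pow d w : rot 1 (pow d w) = pow d (rot 1 w).
Proof.
case: w => [|x v]; first by elim: d.
case: d => [|d] //; rewrite rot1_cons powS cat_cons rot1_cons rcons_cat pow_rcons.
by rewrite powS cat_rcons.
Qed.

Lemma pow_inj d u v : 0 < d -> size u = size v -> pow d u = pow d v -> u = v.
Proof.
case: d => // d _ suv /eqP; rewrite !powS eqseq_cat //.
by case/andP => /eqP.
Qed.

(** Rotation by one commutes with taking powers, and powers are injective on words of equal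
    length. *)
Lemma period_pow d w : 0 < d -> period (pow d w) = period w.
Proof.
move=> d0; apply: eq_period => k; rewrite /fixes.
have -> : iter k (rot 1) (pow d w) = pow d (iter k (rot 1) w).
  by elim: k => [|k IH] //=; rewrite IH rot1_pow.
apply/eqP/eqP => [|-> //]; apply: pow_inj => //.
by rewrite size_iter_rot1.
Qed.

(** Writing [w] as [x ++ y] with [x] of length [k], invariance says that [x] and [y] commute. Hence
    [y] begins with [x] and is again fixed by [k], and induction on the number of blocks applies. *)
Lemma pow_of_fixes w k : fixes w k -> 0 < k -> k %| size w ->
  w = pow (size w %/ k) (take k w).
Proof.
move=> + k0 /dvdnP [d]; elim: d w => [|d IH] w wk sw.
  by rewrite (size0nil sw) div0n.
have kw : k <= size w by rewrite sw mulSn leq_addr.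
have sxk : size (take k w) = k by rewrite size_takel.
have E : drop k w ++ take k w = take k w ++ drop k w.
  by rewrite cat_take_drop; move/eqP: wk; rewrite iter_rot1.
have sy : size (drop k w) = d * k by rewrite size_drop sw mulSn addKn.
rewrite sw mulnK // powS -[LHS](cat_take_drop k); congr (_ ++ _).
case: d => [|d] in IH sw sy *; first by rewrite (size0nil sy).
have ky : k <= size (drop k w) by rewrite sy mulSn leq_addr.
have tE : take k (drop k w) = take k w.
  have := congr1 (take k) E; rewrite take_cat take_size_cat //.
  rewrite ltn_neqAle ky andbT; case: eqP => //= ky'.
  by rewrite -ky' subnn take0 cats0 => <-; rewrite take_oversize -?ky'.
have -> : d.+1 = size (drop k w) %/ k by rewrite sy mulnK.
rewrite -tE; apply: IH => //.
rewrite /fixes iter_rot1 // /rot tE; apply/eqP.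
apply: (@pow_inj 1) => //; first by rewrite size_cat size_drop sxk subnK.
rewrite /pow /= !cats0; move: E.
rewrite -{1}[drop k w](cat_take_drop k) tE -catA => /eqP.
by rewrite eqseq_cat // => /andP [_ /eqP].
Qed.

Lemma cycle_pow (e : rel T) d w : 0 < d -> cycle e (pow d w) = cycle e w.
Proof.
case: d => // d _; case: w => [|x v]; first by elim: d.
rewrite powS cat_cons /= rcons_cat pow_rcons -cat_rcons cat_path last_rcons.
(* Each copy of [rcons v x] ends in [x], so every copy imposes the same condition; with no copy
   there is none. *)
have -> : path e x (pow d (rcons v x)) = path e x (rcons v x) || (d == 0).
  elim: d => [|d IH]; first by rewrite orbT.
  by rewrite powS cat_path last_rcons IH orbF; case: (path _ _ _).
by case: (path _ _ _).
Qed.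

(** Two equal rotations would differ by a shift that fixes [w] and is smaller than its period. *)
Lemma rot_iter_uniq w : w != [::] -> period w = size w ->
  uniq [seq iter i (rot 1) w | i <- iota 0 (size w)].
Proof.
move=> w0 pw; rewrite map_inj_in_uniq ?iota_uniq // => i j.
wlog ij : i j / i <= j.
  by move=> H iw jw E; case: (leqP i j) => [|/ltnW] ij; [|symmetry]; apply: H.
rewrite !mem_iota /= !add0n => _ jw E.
have : fixes w (j - i).
  rewrite /fixes; apply/eqP/(@iter_rot1_inj i).
  by rewrite -iterD subnKC.
rewrite fixes_period pw => /dvdn_leq; rewrite subn_gt0 => D.
apply/eqP; rewrite eqn_leq ij leqNgt; apply/negP => /D.
by rewrite leqNgt (leq_ltn_trans (leq_subr _ _) jw).
Qed.

End Period.

Lemma primitive_period w : w != [::] -> primitive w = (period w == size w).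
Proof.
move=> w0; have sw0 : 0 < size w by rewrite lt0n size_eq0.
apply/idP/idP => [|/eqP pw].
  (* A period smaller than the length exhibits [w] as a power of its prefix of that length. *)
  apply: contraR => pw; apply/hasP; exists (size w %/ period w).
    by rewrite mem_iota add0n /= ltnS leq_div.
  have p0 := period_gt0 w; have /dvdnP [d sw] := period_dvd w.
  have nd : size w %/ period w = d by rewrite sw mulnK.
  have d1 : 1 < d.
    case: d sw {nd} => [|[|d]] // sw; first by rewrite sw in sw0.
    by rewrite [in X in _ == X]sw mul1n eqxx in pw.
  have dw : size w %/ d = period w by rewrite sw mulKn // ltnW.
  rewrite nd d1 dw.
  by apply/eqP; rewrite -nd; apply: pow_of_fixes; rewrite ?fixes_period ?period_dvd.
apply/hasPn => d _; rewrite negb_and; case: (ltnP 1 d) => //= d1.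
apply/negP => /eqP E.
have d0 := ltnW d1.
have su : size (take (size w %/ d) w) = size w %/ d.
  by rewrite size_takel // leq_div.
(* A proper power has the period of its base, which is at most the length of the base. *)
have pE : period w = period (take (size w %/ d) w).
  by rewrite {1}E -/(pow d _) period_pow.
have := period_dvd (take (size w %/ d) w); rewrite su -pE pw => /dvdn_leq H.
have := congr1 size E; rewrite -/(pow d _) size_pow su.
case: (posnP (size w %/ d)) => [->|/H]; last by rewrite leqNgt ltn_Pdiv.
by rewrite muln0 => s0; rewrite s0 in sw0.
Qed.

(** * Rotation classes and their representatives *)

Lemma rot_eqbP w w' : reflect (exists k, w' = iter k (rot 1) w) (rot_eqb w w').
Proof.
apply: (iffP hasP) => [[r]|[k ->]].
  rewrite mem_iota add0n ltnS => rw /eqP <-.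
  by exists r; rewrite iter_rot1.
case: (posnP (size w)) => [/size0nil ->|sw].
  by exists 0 => //; apply/eqP; elim: k => [|k /= <-].
exists (k %% size w); first (by rewrite mem_iota add0n ltnS /=; exact/ltnW/ltn_pmod).
rewrite -iter_rot1; last exact/ltnW/ltn_pmod.
rewrite {2}(divn_eq k (size w)) addnC iterD.
by have /eqP -> := fixesM (k %/ size w) (fixes_size w).
Qed.

Lemma rot_eqb_equiv : equivalence_rel rot_eqb.
Proof.
apply/equivalence_relP; split=> [w|w w' /rot_eqbP [k ->] v].
  by apply/rot_eqbP; exists 0.
apply/rot_eqbP/rot_eqbP => -[m ->]; last by exists (m + k); rewrite iterD.
(* With the [k] rotations already made, [k * (size w).-1] more add up to [k] full turns. *)
exists (m + k * (size w).-1); rewrite -iterD -addnA -mulnSr iterD; congr iter.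
case: w => [|x w]; first by elim: (k * _) => [|i /= <-].
by have /eqP -> := fixesM k (fixes_size (x :: w)).
Qed.

Lemma rot_eqb_refl w : rot_eqb w w.
Proof. exact: (rot_eqb_equiv w w w).1. Qed.

(** Related elements define the same predicate, from which [choose] picks the same element: it
    selects one representative per class. *)
Lemma choose_equivE (T : choiceType) (R : rel T) x y : equivalence_rel R ->
  (choose (R x) x == choose (R y) y) = R x y.
Proof.
move=> /equivalence_relP [refR trR]; apply/eqP/idP => [E|xy].
  rewrite (trR _ _ (chooseP (refR x))) E -(trR _ _ (chooseP (refR y))).
  exact: refR.
rewrite (eq_choose (trR _ _ xy)); apply: choose_id; last exact: refR.
by rewrite -(trR _ _ xy).
Qed.

Definition canon w : seq letter := choose (rot_eqb w) w.

Lemma rot_eqb_canon w : rot_eqb w (canon w).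
Proof. exact/chooseP/rot_eqb_refl. Qed.

Lemma canonE w w' : (canon w == canon w') = rot_eqb w w'.
Proof. exact: choose_equivE rot_eqb_equiv. Qed.

Lemma canon_id w : canon (canon w) = canon w.
Proof. have [_ tr] := rot_eqb_equiv w (canon w) w.
by apply/eqP; rewrite canonE -tr ?rot_eqb_refl ?rot_eqb_canon. Qed.

Lemma perm_rot_eqb w w' : rot_eqb w w' -> perm_eq w' w.
Proof. by move=> /rot_eqbP [k ->]; apply: perm_iter_rot1. Qed.

Lemma rot_eqb_primitive w w' : rot_eqb w w' -> primitive w' = primitive w.
Proof.
move=> ww'; have pw := perm_size (perm_rot_eqb ww').
case: (altP (w =P [::])) => [w0|w0]; first by rewrite w0 in pw *; rewrite (size0nil pw).
have w'0 : w' != [::] by rewrite -size_eq0 pw size_eq0.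
rewrite !primitive_period // pw; move: ww' => /rot_eqbP [k ->].
by rewrite period_iter_rot1.
Qed.

Lemma rot_eqb_cycle (e : rel letter) w w' : rot_eqb w w' -> cycle e w' = cycle e w.
Proof.
by move=> /rot_eqbP [k ->]; elim: k => //= k IH; rewrite rot_cycle.
Qed.

Lemma size_undup_regular (T : eqType) n (s : seq T) :
  (forall x, x \in s -> count_mem x s = n) -> size s = size (undup s) * n.
Proof.
move=> H; rewrite -(perm_size (perm_count_undup s)) size_flatten /shape -map_comp.
have /eq_in_map -> : {in undup s, size \o (fun x => nseq (count_mem x s) x) =1 fun=> n}.
  by move=> x; rewrite mem_undup /= size_nseq => /H.
by elim: (undup s) => //= x r ->; rewrite mulSn.
Qed.

(** A primitive word of length [n] has exactly [n] distinct rotations. *)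
Lemma size_rot_classes n (s : seq (seq letter)) : 0 < n -> uniq s ->
  {in s, forall w, size w = n /\ primitive w} ->
  (forall w w', rot_eqb w w' -> w \in s -> w' \in s) ->
  size s = size (undup (map canon s)) * n.
Proof.
move=> n0 us sn sr; rewrite -(size_map canon s).
apply: size_undup_regular => c /mapP [w ws ->].
have [sw pw] := sn w ws.
have w0 : w != [::] by rewrite -size_eq0 sw -lt0n.
rewrite primitive_period // in pw; move/eqP: pw => pw.
rewrite count_map -size_filter.
rewrite -sw -[RHS](size_iota 0) -(size_map (fun i => iter i (rot 1) w)).
apply/perm_size/uniq_perm; rewrite ?filter_uniq ?rot_iter_uniq // => v.
rewrite mem_filter /= eq_sym canonE; apply/andP/mapP.
  case=> /hasP [i]; rewrite mem_iota add0n ltnS => iw /eqP <- _.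
  (* [rot_eqb] also tries the full turn, which is the same as no rotation. *)
  case: (ltngtP i (size w)) iw => // [iw _|-> _].
    by exists i; rewrite ?mem_iota // iter_rot1 // ltnW.
  by exists 0; rewrite ?rot_size // mem_iota /= sw.
move=> [i _ ->]; have ww : rot_eqb w (iter i (rot 1) w) by apply/rot_eqbP; exists i.
by split=> //; apply: sr ws.
Qed.

(** * Primitive closed words *)

Lemma wt_pow p h d w : wt p h (pow d w) = d * wt p h w.
Proof.
rewrite /wt; elim: d => [|d IH]; first by rewrite big_nil.
by rewrite powS big_cat /= IH mulSn.
Qed.

Lemma count_partition (T : Type) (k : T -> nat) (ds : seq nat) (a : pred T) (s : seq T) :
  uniq ds -> all (fun x => k x \in ds) s ->
  count a s = \sum_(q <- ds) count (fun x => (k x == q) && a x) s.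
Proof.
move=> uds; elim: s => [|x s IH] /=; first by rewrite big1.
case/andP => kx /IH ->; rewrite big_split /=; congr (_ + _).
rewrite (bigD1_seq _ kx uds) /= eqxx big1 ?addn0 // => q.
by rewrite eq_sym => /negbTE ->.
Qed.

Section PrimitiveCount.
Variables (L : seq letter) (p : nat -> nat) (h : nat * bool -> nat).
Hypothesis uL : uniq L.

Definition prim_words (r : rel letter) n e :=
  [seq w <- words L n | [&& primitive w, cycle r w & wt p h w == e]].

(** Words of length [n] and period [q] are the [n %/ q]-th powers of primitive words of length [q],
    and the weight is multiplied by the same factor. *)
Lemma count_period r n q e : q %| n -> 0 < n ->
  count (fun w => (period w == q) && (cycle r w && (wt p h w == e))) (words L n) =
  if n %/ q %| e then size (prim_words r q (e %/ (n %/ q))) else 0.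
Proof.
case/dvdnP => d -> dq0.
have q0 : 0 < q by rewrite lt0n; apply: contraTneq dq0 => ->; rewrite muln0.
have d0 : 0 < d by rewrite lt0n; apply: contraTneq dq0 => ->.
rewrite mulnK //; set s := words L (d * q).
transitivity (size [seq u <- words L q | [&& primitive u, cycle r u & d * wt p h u == e]]).
  rewrite -size_filter -[RHS](size_map (@pow _ d)); apply/perm_size/uniq_perm.
  - exact/filter_uniq/words_uniq.
  - rewrite map_inj_in_uniq ?filter_uniq ?words_uniq // => u v.
    rewrite !mem_filter !mem_words => /and3P [_ /eqP su _] /and3P [_ /eqP sv _].
    by apply: pow_inj => //; rewrite su.
  move=> w; rewrite mem_filter mem_words; apply/andP/mapP.
    case=> /and3P [/eqP pw cw /eqP ww] /andP [/eqP sw wL].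
    have E : w = pow d (take q w).
      have := @pow_of_fixes _ w q; rewrite sw mulnK // fixes_period pw dvdnn.
      by rewrite dvdn_mull //; apply.
    have su : size (take q w) = q by rewrite size_takel // sw leq_pmull.
    have u0 : take q w != [::] by rewrite -size_eq0 su -lt0n.
    exists (take q w) => //; rewrite mem_filter mem_words su eqxx.
    rewrite primitive_period // su -wt_pow -(period_pow _ d0) -(cycle_pow r _ d0) -E.
    rewrite pw eqxx cw ww eqxx /=.
    by apply/allP => x /mem_take; apply/allP.
  case=> u; rewrite mem_filter mem_words => /and3P [/and3P [pu cu wu] /eqP su uL' ->].
  have u0 : u != [::] by rewrite -size_eq0 su -lt0n.
  rewrite primitive_period // su in pu.
  rewrite period_pow // cycle_pow // wt_pow pu cu wu size_pow su eqxx; split=> //.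
  by apply/allP => x /flattenP [v /nseqP [-> _]]; apply/allP.
rewrite /prim_words; case: ifP => de.
  congr size; apply: eq_filter => u; congr [&& _, _ & _].
  by rewrite -{1}(divnK de) mulnC eqn_pmul2r.
rewrite size_filter (eq_count (a2 := pred0)) ?count_pred0 // => u /=.
apply/negbTE/and3P => -[_ _ /eqP E].
by rewrite -E dvdn_mulr in de.
Qed.

Lemma count_cyclic_sum r n e : 0 < n ->
  count (fun w => cycle r w && (wt p h w == e)) (words L n) =
  \sum_(q <- divisors n)
    if n %/ q %| e then size (prim_words r q (e %/ (n %/ q))) else 0.
Proof.
move=> n0; rewrite (@count_partition _ (@period _) (divisors n)) ?divisors_uniq //.
  apply: eq_big_seq => q; rewrite -dvdn_divisors // => qn.
  exact: count_period.
apply/allP => w; rewrite mem_words => /andP [/eqP sw _].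
by rewrite -dvdn_divisors // -sw period_dvd.
Qed.

(** Inversion of the divisor sum by strong induction: the terms for proper divisors agree, so the
    term [q = n] can be cancelled out. *)
Lemma size_prim_words r1 r2 :
  (forall n e, 0 < n ->
    count (fun w => cycle r1 w && (wt p h w == e)) (words L n) =
    count (fun w => cycle r2 w && (wt p h w == e)) (words L n)) ->
  forall n e, 0 < n -> size (prim_words r1 n e) = size (prim_words r2 n e).
Proof.
move=> H n; have [m] := ubnP n; elim: m n => // m IH n nm e n0.
have := H n e n0; rewrite !count_cyclic_sum //.
have nn : n \in divisors n by rewrite -dvdn_divisors.
rewrite !(bigD1_seq _ nn (divisors_uniq n)) /= divnn n0 dvd1n divn1.
have -> : \sum_(q <- divisors n | q != n)
      (if n %/ q %| e then size (prim_words r1 q (e %/ (n %/ q))) else 0) =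
    \sum_(q <- divisors n | q != n)
      (if n %/ q %| e then size (prim_words r2 q (e %/ (n %/ q))) else 0).
  rewrite big_seq_cond [RHS]big_seq_cond; apply: eq_bigr => q.
  rewrite -dvdn_divisors // => /andP [qn qn'].
  case: ifP => // _; apply: IH; last by rewrite (dvdn_gt0 n0 qn).
  by apply: (leq_trans _ (nm : n <= m)); rewrite ltn_neqAle qn' dvdn_leq.
exact: addIn.
Qed.

Definition classes r n e := undup (map canon (prim_words r n e)).

Lemma rot_eqb_prim_words r n e w w' :
  rot_eqb w w' -> w \in prim_words r n e -> w' \in prim_words r n e.
Proof.
move=> ww'; rewrite !mem_filter !mem_words.
have pw := perm_rot_eqb ww'.
rewrite (rot_eqb_primitive ww') (rot_eqb_cycle r ww') /wt (perm_big _ pw).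
by rewrite (perm_size pw) (perm_all _ pw).
Qed.

Lemma size_classes r n e : 0 < n -> size (prim_words r n e) = size (classes r n e) * n.
Proof.
move=> n0; apply: size_rot_classes => //; first exact/filter_uniq/words_uniq.
  by move=> w; rewrite mem_filter mem_words => /andP [/andP [-> _] /andP [/eqP ->]].
exact: rot_eqb_prim_words.
Qed.

Lemma mem_classes r n e w :
  (w \in classes r n e) = (canon w == w) && (w \in prim_words r n e).
Proof.
rewrite mem_undup; apply/mapP/andP => [[v vP ->]|[/eqP cw wP]]; last by exists w.
by rewrite canon_id eqxx; split=> //; apply: rot_eqb_prim_words vP; apply: rot_eqb_canon.
Qed.

End PrimitiveCount.

(** Each class consists of [n] primitive closed words, so equality of the word counts can be divided
    by [n]. *)
Lemma size_classes_follow N CB p h f g n e : uniq CB ->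
  injective f -> injective g -> 0 < n ->
  size (classes (alphabet N CB) p h (follow f) n e) =
  size (classes (alphabet N CB) p h (follow g) n e).
Proof.
move=> uCB injf injg n0; apply/eqP; rewrite -(eqn_pmul2r n0).
rewrite -!size_classes ?alphabet_uniq //; apply/eqP.
apply: size_prim_words => //; first exact: alphabet_uniq.
by move=> m e' m0; apply: count_cyclic_words.
Qed.

(** * Letter statistics *)

Lemma eq_digits B K (a b : nat -> nat) :
  (forall j, a j < B) -> (forall j, b j < B) ->
  \sum_(j < K) a j * B ^ j = \sum_(j < K) b j * B ^ j ->
  forall j, j < K -> a j = b j.
Proof.
elim: K a b => [|K IH] a b aB bB //.
have S (c : nat -> nat) : \sum_(j < K.+1) c j * B ^ j = (\sum_(j < K) c j.+1 * B ^ j) * B + c 0.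
  rewrite big_ord_recl muln1 addnC big_distrl /=; congr (_ + _).
  by apply: eq_bigr => j _; rewrite expnSr mulnA.
rewrite !S => E [_|j jK]; first by have := congr1 (modn^~ B) E; rewrite !modnMDl !modn_small.
have B0 : 0 < B by apply: leq_ltn_trans (aB 0).
apply: (IH (a \o succn) (b \o succn)) => //=.
have := congr1 (divn^~ B) E.
by rewrite !divnMDl // !divn_small // !addn0.
Qed.

Section Statistics.
Variables (l N B : nat).

Definition kinds : seq (nat * bool) :=
  [seq c <- [seq (m, b) | m <- iota 0 l, b <- [:: false; true]] | c.2 ==> (c.1 == 0)].

Lemma kinds_uniq : uniq kinds.
Proof.
apply/filter_uniq/allpairs_uniq; rewrite ?iota_uniq //.
by move=> [m b] [m' b'] _ _ /= [-> ->].
Qed.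

Lemma mem_kinds c : (c \in kinds) = (c.1 < l) && (c.2 ==> (c.1 == 0)).
Proof.
case: c => m b; rewrite mem_filter andbC; congr andb.
apply/allpairsP/idP => [[[m' b'] /= [+ _ [-> _]]]|ml]; first by rewrite mem_iota.
by exists (m, b); rewrite mem_iota; case: (b).
Qed.

Lemma valid_letterE x : valid_letter l x = (0 < labs x) && ((lcol x, lbar x) \in kinds).
Proof. by rewrite mem_kinds. Qed.

(* [code w] has base-B digits: at j < N the number of letters of absolute value j,
   at N the number of barred letters, at N.+1 + m the number of m-colored letters. *)
Definition abs_digit j u : nat := (j < N) && (u == j).
Definition kind_digit j (c : nat * bool) : nat :=
  if j < N then 0 else if j == N then c.2 else c.1 == j - N.+1.
Definition abs_weight u := \sum_(j < N.+1 + l) abs_digit j u * B ^ j.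
Definition kind_weight c := \sum_(j < N.+1 + l) kind_digit j c * B ^ j.
Definition digit w j := \sum_(x <- w) (abs_digit j (labs x) + kind_digit j (lcol x, lbar x)).
Definition code := wt abs_weight kind_weight.

Lemma codeE w : code w = \sum_(j < N.+1 + l) digit w j * B ^ j.
Proof.
rewrite /code /wt; under eq_bigr => x _ do rewrite -big_split /=.
rewrite exchange_big; apply: eq_bigr => j _; rewrite big_distrl /=.
by apply: eq_bigr => x _; rewrite mulnDl.
Qed.

(** Each letter adds at most 1 to a digit, so a base exceeding the length of the word leaves no
    carries. *)
Lemma digit_le w j : digit w j <= size w.
Proof.
rewrite -sum1_size; apply: leq_sum => x _; rewrite /abs_digit /kind_digit.
by case: ltnP => _ /=; [case: (_ == _)|case: ifP => _; case: (lbar _) => //=; case: (_ == _)].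
Qed.

Lemma digit_abs w j : j < N -> digit w j = count_mem j (map labs w).
Proof.
move=> jN; rewrite count_map -sum1_count [RHS]big_mkcond; apply: eq_bigr => x _ /=.
by rewrite /abs_digit /kind_digit jN addn0 /=; case: (_ == _).
Qed.

Lemma digit_bar w : digit w N = count lbar w.
Proof.
rewrite -sum1_count [RHS]big_mkcond; apply: eq_bigr => x _ /=.
by rewrite /abs_digit /kind_digit ltnn eqxx /=; case: (lbar _).
Qed.

Lemma digit_col w m : digit w (N.+1 + m) = count (fun x => lcol x == m) w.
Proof.
rewrite -sum1_count [RHS]big_mkcond; apply: eq_bigr => x _ /=.
rewrite /abs_digit /kind_digit ltnNge (leq_trans (leqnSn N)) ?leq_addr //=.
by rewrite gtn_eqF ?ltn_addr // addKn /=; case: (_ == _).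
Qed.

Lemma code_inj w w' : size w < B -> size w' < B ->
  all (fun x => labs x < N) w -> all (fun x => labs x < N) w' -> code w = code w' ->
  [/\ perm_eq (map labs w) (map labs w'), count lbar w = count lbar w' &
      forall m, m < l -> count (fun x => lcol x == m) w = count (fun x => lcol x == m) w'].
Proof.
move=> sw sw' wN w'N; rewrite !codeE => /eq_digits H.
have {}H j : j < N.+1 + l -> digit w j = digit w' j.
  by apply: H => i; apply: leq_ltn_trans (digit_le _ _) _.
split; last by move=> m ml; rewrite -!digit_col H // ltn_add2l.
  apply/allP => u; rewrite mem_cat => uw /=.
  have uN : u < N by case/orP: uw => /mapP [x xw ->]; [apply: (allP wN)|apply: (allP w'N)].
  by rewrite -!digit_abs // H // ltn_addr // ltnW.
by rewrite -!digit_bar H // ltn_addr.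
Qed.

End Statistics.

(** * Transport of necklaces along a relabeling *)

Lemma all_zip_rot1 (T : Type) (e : rel T) w :
  all (fun p => e p.1 p.2) (zip w (rot 1 w)) = cycle e w.
Proof.
case: w => [|x w] //; rewrite rot1_cons /=.
by elim: w {1 3}x => [|y w IH] z //=; rewrite ?andbT // IH.
Qed.

Lemma relab_inj f : injective f -> injective (relab f).
Proof.
move=> injf [[u m] b] [[v n] c].
by rewrite /relab /labs /lcol /lbar /= => -[/injf -> -> ->].
Qed.

Lemma map_iter_rot1 (T U : Type) (f : T -> U) k w :
  map f (iter k (rot 1) w) = iter k (rot 1) (map f w).
Proof. by elim: k => //= k IH; rewrite map_rot IH. Qed.

Lemma primitive_relab f w : injective f -> primitive (map (relab f) w) = primitive w.
Proof.
move=> injf; case: w => [|x w] //; rewrite !primitive_period // size_map.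
congr (_ == _); apply: eq_period => k; rewrite /fixes -map_iter_rot1.
by rewrite (inj_eq (inj_map (relab_inj injf))).
Qed.

Lemma rot_eqb_relab f w w' : injective f ->
  rot_eqb (map (relab f) w) (map (relab f) w') -> rot_eqb w w'.
Proof.
move=> injf /rot_eqbP [k]; rewrite -map_iter_rot1 => /(inj_map (relab_inj injf)) ->.
by apply/rot_eqbP; exists k.
Qed.

(** The condition on length one is phrased by the number of barred letters, which is one of the
    statistics recorded by [code]. *)
Lemma necklaceE l w : necklace l w = [&& 0 < size w, all (valid_letter l) w, primitive w,
  cycle (follow id) w & (size w == 1) ==> (count lbar w == 0)].
Proof.
rewrite /necklace (all_zip_rot1 follow_ok); congr [&& _, _, _, _ & _].
by case: w => [|x [|y w]] //=; case: (lbar x).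
Qed.

Section NecklaceMap.
Variables (l N B : nat) (f : nat -> nat).
Hypotheses (injf : injective f) (f0 : f 0 = 0).

Let cls g w := classes (alphabet N (kinds l)) (abs_weight l N B) (kind_weight l N B)
  (follow g) (size w) (code l N B w).

(* Send the i-th class of necklaces with a given code to the i-th class of those that
   are necklaces once relabeled by f: there are equally many of each. *)
Definition necklace_map_rep w := nth [::] (cls f w) (index (canon w) (cls id w)).
Definition necklace_map w := map (relab f) (necklace_map_rep w).

Definition small w := all (fun x => labs x < N) w && (size w < B).

Lemma canon_mem_cls w : necklace l w -> small w -> canon w \in cls id w.
Proof.
rewrite necklaceE /small => /and5P [_ vw pw cw _] /andP [wN _].
rewrite /cls mem_classes canon_id eqxx /=.
apply: rot_eqb_prim_words (rot_eqb_canon w) _.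
rewrite mem_filter pw cw mem_words !eqxx /=; apply/allP => x xw /=.
rewrite mem_alphabet (allP wN) //=.
by have := allP vw x xw; rewrite valid_letterE => /andP [].
Qed.

Lemma size_cls w : 0 < size w -> size (cls f w) = size (cls id w).
Proof. by move=> w0; apply: size_classes_follow => //; apply: kinds_uniq. Qed.

Lemma necklace_map_rep_mem w : necklace l w -> small w -> necklace_map_rep w \in cls f w.
Proof.
move=> nw sw; rewrite mem_nth // size_cls ?index_mem ?canon_mem_cls //.
by case/andP: nw.
Qed.

(** A common image reveals the length and the code of both necklaces, so both are looked up in the
    same duplicate-free lists and have the same position there. *)
Lemma necklace_map_rot_eqb w w' : necklace l w -> small w -> necklace l w' -> small w' ->
  rot_eqb (necklace_map w) (necklace_map w') -> rot_eqb w w'.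
Proof.
move=> nw sw nw' sw' /(rot_eqb_relab injf); rewrite -!canonE.
have := necklace_map_rep_mem nw sw; have := necklace_map_rep_mem nw' sw'.
rewrite /cls !mem_classes => /andP [/eqP -> m'] /andP [/eqP -> m] /eqP E.
have sE : size w = size w'.
  move: m m'; rewrite E !mem_filter !mem_words.
  by case/and3P => _ /eqP <- _ /and3P [_ /eqP <- _].
have cE : code l N B w = code l N B w'.
  move: m m'; rewrite E !mem_filter.
  by case/andP => /and3P [_ _ /eqP <-] _ /andP [/and3P [_ _ /eqP <-] _].
have C g : cls g w = cls g w' by rewrite /cls sE cE.
have w0 : 0 < size w by case/andP: nw.
have cw := canon_mem_cls nw sw; have cw' := canon_mem_cls nw' sw'.
move/eqP: E; rewrite /necklace_map_rep !C nth_uniq ?undup_uniq // -?C ?size_cls ?index_mem //; last first.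
  by rewrite C.
by move=> /eqP E; rewrite -(nth_index [::] cw) E C nth_index // -C.
Qed.

Lemma necklace_mapP w : necklace l w -> small w ->
  [/\ necklace l (necklace_map w), size (necklace_map w) = size w, colvec l (necklace_map w) = colvec l w,
      count lbar (necklace_map w) = count lbar w &
      perm_eq (map labs (necklace_map w)) (map f (map labs w))].
Proof.
move=> nw sw; have := necklace_map_rep_mem nw sw.
move: nw; rewrite necklaceE => /and5P [w0 vw pw cw bw].
case/andP: sw => wN wB.
rewrite mem_classes => /andP [_]; rewrite /necklace_map; set u := necklace_map_rep w.
rewrite mem_filter mem_words => /andP [/and3P [pu cu /eqP uw] /andP [/eqP su uL]].
have uN : all (fun x => labs x < N) u.
  by apply/allP => x xu; have := allP uL x xu; rewrite /= mem_alphabet => /andP [].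
have [uwl uwb uwc] := code_inj (eq_ind_r (fun n => n < B) wB su) wB uN wN uw.
have bE : count lbar (map (relab f) u) = count lbar w by rewrite count_map -uwb.
split=> //.
- rewrite necklaceE size_map su w0 primitive_relab // pu bE bw /=.
  (* Relabeling by [f] turns the relation [follow f] into the ordinary following rule. *)
  rewrite (mono_cycle (f := relab f) (e := follow f)) ?cu ?andbT //.
  apply/allP => _ /mapP [x xu ->]; rewrite valid_letterE.
  have := allP uL x xu; rewrite /= mem_alphabet => /andP [_ ->]; rewrite andbT.
  (* The absolute values of [u] are those of [w], hence positive, and stay so because [f] is
     injective and fixes 0. *)
  rewrite /labs /= lt0n -f0 (inj_eq injf) -lt0n.
  have : labs x \in map labs w by rewrite -(perm_mem uwl) map_f.
  by case/mapP => y yw ->; have := allP vw y yw => /andP [].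
- by rewrite size_map.
- apply/eq_in_map => m; rewrite mem_iota count_map => /andP [m0 ml].
  by rewrite -uwc //; move: m0 ml; case: (l) => [|n] //; case: (m).
- by rewrite -map_comp (eq_map (g := f \o labs)) // map_comp perm_map.
Qed.

End NecklaceMap.

(** * Ornaments *)

Lemma perm_rem_nth (T : eqType) (x : T) j s : j < size s ->
  perm_eq (nth x s j :: rem_nth j s) s.
Proof.
move=> js; rewrite -[X in perm_eq _ X](cat_take_drop j) (drop_nth x) // /rem_nth.
by rewrite perm_sym -cat1s perm_catCA.
Qed.

(** The search succeeds exactly when the multisets of rotation classes coincide: any partner chosen
    for [w] has the same representative, so removing it loses nothing. *)
Lemma orn_eqE o o' : orn_eq o o' = perm_eq (map canon o) (map canon o').
Proof.
elim: o o' => [|w o IH] o' /=.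
  by rewrite perm_sym; apply/eqP/perm_nilP; case: o'.
have key j : j < size o' ->
    perm_eq (map canon o') (canon (nth [::] o' j) :: map canon (rem_nth j o')).
  by move=> jo; rewrite perm_sym -map_cons perm_map // perm_rem_nth.
apply/hasP/idP => [[j]|P].
  rewrite mem_iota => jo /andP [wj]; rewrite IH => P.
  rewrite perm_sym (permPl (key j jo)); move: wj; rewrite -canonE => /eqP <-.
  by rewrite perm_cons perm_sym.
have : canon w \in map canon o' by rewrite -(perm_mem P) mem_head.
move=> /(nthP [::]) [j]; rewrite size_map => jo; rewrite (nth_map [::]) // => E.
exists j; first by rewrite mem_iota.
rewrite -canonE E eqxx IH -(perm_cons (canon w)) -{2}E.
by rewrite (permPl P) key.
Qed.

(** A class is counted at the last of its members in [s]. *)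
Lemma nclassesE (T : Type) (G : eqType) (e : rel T) (g : T -> G) s :
  (forall x y, e x y = (g x == g y)) -> nclasses e s = size (undup (map g s)).
Proof.
move=> E; elim: s => [|x s IH] //=; rewrite IH.
have -> : has (e x) s = (g x \in map g s).
  by elim: s {IH} => [|y s IHs] //=; rewrite in_cons E IHs.
by case: (g x \in _).
Qed.

Lemma size_undup_map_le (T U G H : eqType) (g : T -> G) (h : U -> H) (F : T -> U) s s' :
  {in s, forall x, F x \in s'} ->
  {in s &, forall x y, h (F x) = h (F y) -> g x = g y} ->
  size (undup (map g s)) <= size (undup (map h s')).
Proof.
move=> Fs inj.
(* [r] keeps one element of [s] for each value of [g]; [F] then sends these to distinct values of
   [h]. *)
have [r rs rE] : exists2 r, {subset r <= s} & map g r = undup (map g s).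
  elim: s {Fs inj} => [|x s [r rs rE]] /=; first by exists [::].
  case: ifP => _; first by exists r => // y /rs ys; rewrite in_cons ys orbT.
  exists (x :: r); last by rewrite /= rE.
  by move=> y; rewrite !in_cons => /orP [-> //|/rs ->]; rewrite orbT.
rewrite -rE size_map -(size_map (h \o F)); apply: uniq_leq_size; last first.
  by move=> _ /mapP [x /rs xs ->]; rewrite mem_undup /=; apply/map_f/Fs.
have := undup_uniq (map g s); rewrite -rE; elim: r rs {rE} => [|x r IH] //= rs.
have xr y : y \in r -> y \in s by move=> yr; apply: rs; rewrite in_cons yr orbT.
case/andP => gx /(IH xr) ->; rewrite andbT; apply: contra gx => /mapP [y yr E].
have xs : x \in s by rewrite rs ?mem_head.
by rewrite (inj x y xs (xr y yr) E) map_f.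
Qed.

Lemma mem_cand_orns L lam o :
  (o \in cand_orns L lam) = all2 (fun w p => w \in words L p.1) o lam.
Proof.
elim: lam o => [|p lam IH] [|w o] //=; first by apply/allpairsP => -[[? ?] []].
rewrite -IH; apply/allpairsP/andP => [[[v o1] [/= ? ? [-> ->]]]//|[wL oL]].
by exists (w, o).
Qed.

Lemma mem_letters_of l mon x : labs x \in mon -> valid_letter l x -> x \in letters_of l mon.
Proof.
move=> xm vx; rewrite mem_filter vx /=; apply/flattenP.
exists [seq ((labs x, m), b) | m <- iota 0 l, b <- [:: false; true]].
  by apply/mapP; exists (labs x); rewrite ?mem_undup.
apply/allpairsP; exists (lcol x, lbar x).
case/and3P: vx => _ lx _; case: x {xm} lx => [[u m] b] /= lx.
by rewrite mem_iota; case: (b).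
Qed.

(** Applying [necklace_map] to each necklace injects the ornaments of weight [mon] into those of
    weight [map f mon]. An inequality suffices, since the inverse relabeling gives the reverse
    one. *)
Lemma Qcoef_le l lam k f mon : injective f -> f 0 = 0 ->
  Qcoef l lam k mon <= Qcoef l lam k (map f mon).
Proof.
(* [N] exceeds every entry of [mon], and [B] exceeds the total length of an ornament of this weight,
   so all its necklaces are [small]. *)
move=> injf f0; pose N := (sumn mon).+1; pose B := (size mon).+1.
have P_equiv : equivalence_rel (fun a b : seq (seq letter) => perm_eq a b).
  apply/equivalence_relP; split=> [a|a b ab c]; first exact: perm_refl.
  by apply/idP/idP; rewrite (permPl ab).
pose g (o : seq (seq letter)) := choose (perm_eq (map canon o)) (map canon o).
have gE o o' : orn_eq o o' = (g o == g o').
  by rewrite orn_eqE [RHS](choose_equivE _ _ P_equiv).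
rewrite /Qcoef !(nclassesE _ gE).
have monN u : u \in mon -> u < N.
  rewrite /N ltnS; elim: (mon) => //= v s IH; rewrite in_cons => /orP [/eqP ->|/IH us].
    exact: leq_addr.
  exact: leq_trans us (leq_addl _ _).
have good_small o w : good_orn l lam k mon o -> w \in o ->
    necklace l w /\ small N B w.
  case/and3P => al _ pm wo; split.
    elim: o (lam) al {pm} wo => [|v o IH] [|p lam'] //= /andP [/and3P [nv _ _] al].
    by rewrite in_cons => /orP [/eqP -> //|]; apply: IH al.
  have wsub : {subset map labs w <= mon}.
    move=> u uw; rewrite -(perm_mem pm); apply/flattenP.
    by exists (map labs w) => //; apply: map_f.
  apply/andP; split; first by apply/allP => x xw; apply/monN/wsub/map_f.
  rewrite /B ltnS -(perm_size pm); elim: (o) wo => //= v o' IH; rewrite size_cat size_map in_cons.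
  case/orP => [/eqP ->|/IH wv]; first exact: leq_addr.
  exact: leq_trans wv (leq_addl _ _).
apply: (@size_undup_map_le _ _ _ _ _ _ (map (necklace_map l N B f))) => [o|o o'].
  rewrite mem_filter => /andP [go _]; have gs w := good_small _ w go.
  have np w : w \in o -> _ := fun wo => let: conj a b := gs w wo in necklace_mapP injf f0 a b.
  case/and3P: go => al bk pm.
  have pm' : perm_eq (flatten [seq map labs w | w <- map (necklace_map l N B f) o]) (map f mon).
    rewrite -(permPr (perm_map f pm)) map_flatten -!map_comp.
    elim: (o) np => //= w o' IH np.
    have [_ _ _ _ pw] := np w (mem_head _ _).
    by apply: perm_cat => //; apply: IH => v vo; apply: np; rewrite in_cons vo orbT.
  rewrite mem_filter mem_cand_orns; apply/andP; split; last first.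
    have sub w : w \in o -> all (mem (letters_of l (map f mon))) (necklace_map l N B f w).
      move=> wo; have [nw _ _ _ _] := np w wo; apply/allP => x xw.
      apply: mem_letters_of; last by case/and5P: nw => _ /allP vw _ _ _; apply: vw.
      rewrite -(perm_mem pm'); apply/flattenP.
      by exists (map labs (necklace_map l N B f w)); rewrite ?map_f // -map_comp map_f.
    elim: o (lam) al np sub {gs bk pm pm'} => [|w o IH] [|p lam'] //=.
    move=> /andP [/and3P [_ sw _] al] np sub.
    have [_ sE _ _ _] := np w (mem_head _ _).
    rewrite mem_words sE sw sub ?mem_head //=.
    by apply: IH => // v vo; [apply: np|apply: sub]; rewrite in_cons vo orbT.
  apply/and3P; split=> //.
    elim: o (lam) al np {gs bk pm pm'} => [|w o IH] [|p lam'] //= /andP [/and3P [_ sw cw] al] np.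
    have [nw sE cE _ _] := np w (mem_head _ _).
    rewrite nw sE cE sw cw /=.
    by apply: IH => // v vo; apply: np; rewrite in_cons vo orbT.
  rewrite -map_comp (_ : map _ o = [seq count lbar w | w <- o]) //.
  by apply/eq_in_map => w wo /=; have [] := np w wo.
rewrite !mem_filter => /andP [go _] /andP [go' _] /eqP; rewrite -gE => E.
apply/eqP; rewrite -gE; move: E.
have gs w := good_small _ w go; have gs' w := good_small _ w go'.
(* Follow the matching of the images: each matched pair comes from a matched pair of originals at
   the same position. *)
elim: o o' {go go'} gs gs' => [|w o IH] o' gs gs'; first by rewrite /= -!size_eq0 size_map.
move=> /= /hasP [j]; rewrite mem_iota size_map => jo /andP [rw ro].
apply/hasP; exists j; first by rewrite mem_iota.
have mj : nth [::] o' j \in o' by rewrite mem_nth.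
rewrite (nth_map [::]) // in rw.
have [nw sw] := gs w (mem_head _ _); have [nj sj] := gs' _ mj.
rewrite (necklace_map_rot_eqb injf nw sw nj sj rw) /=; apply: IH.
- by move=> v vo; apply: gs; rewrite in_cons vo orbT.
- move=> v vo; apply: gs'; rewrite -(perm_mem (perm_rem_nth [::] jo)).
  by rewrite in_cons vo orbT.
by move: ro; rewrite /rem_nth map_cat map_take map_drop.
Qed.

(* Q_{lam,k} is symmetric: for every permutation sigma of the positive
   integers (variables x_1, x_2, ...), the coefficient of
   x_{sigma u_1} ... x_{sigma u_n} equals that of x_{u_1} ... x_{u_n}. *)
Theorem theorem2p5 (l : nat) (lam : cvtype) (k : nat) :
  0 < l -> wf_cvtype l lam ->
  forall sigma : nat -> nat, bijective sigma -> sigma 0 = 0 ->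
  forall mon : seq nat, Qcoef l lam k (map sigma mon) = Qcoef l lam k mon.
Proof.
move=> _ _ sigma [tau sK tK] s0 mon.
have t0 : tau 0 = 0 by rewrite -s0 sK.
apply/eqP; rewrite eqn_leq; apply/andP; split; last exact: Qcoef_le (can_inj sK) s0.
(* Here [mon] is rewritten as the image of [map sigma mon] under the inverse [tau]. *)
by rewrite -[X in _ <= Qcoef _ _ _ X](mapK sK) Qcoef_le //; apply: can_inj tK.
Qed.
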